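(* For all integers $k\ge1$, \[|\beta_{k,k}|\le\frac{1}{\sqrt{2k}}.\] Furthermore, $\beta_{k,k}=-\frac{1}{\sqrt{2k}}$ if there is a symmetric Hadamard matrix of order $2k$.
   Context: For a graph on $n$ vertices, $\lambda_1\ge\cdots\ge\lambda_n$ are the eigenvalues of its adjacency matrix. Let $\mathcal G_n$ be the family of simple graphs on $n$ vertices, with $\overline{G}$ the usual complement. For fixed positive integers $i,j$, \[\beta_{i,j}=\lim_{n\to\infty}\frac1n\min_{G\in\mathcal G_n}\bigl(\lambda_{n-i+1}(G)+\lambda_{n-j+1}(\overline{G})\bigr),\] a limit which is known to exist (Nikiforov). A Hadamard matrix of order $m$ is an $m\times m$ matrix $H$ with entries $\pm1$ and $HH^T=mI$. *)

(* Defs.v *)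
From HB Require Import structures.
From mathcomp Require Import all_boot all_order all_algebra.
From mathcomp Require Import complex.
From mathcomp Require Import all_classical all_reals all_analysis.
Set Implicit Arguments.
Unset Strict Implicit.
Unset Printing Implicit Defensive.
Import Order.TTheory GRing.Theory Num.Theory.
Import numFieldNormedType.Exports.
Local Open Scope classical_set_scope.
Local Open Scope ring_scope.

Definition is_simple_graph n (e : {ffun 'I_n * 'I_n -> bool}) : bool :=
  [forall i, ~~ e (i, i)] && [forall i, forall j, e (i, j) == e (j, i)].

Record sgraph n := SGraph {
  edges :> {ffun 'I_n * 'I_n -> bool};
  edgesP : is_simple_graph edges }.

HB.instance Definition _ n := [isSub for @edges n].
HB.instance Definition _ n := [Finite of sgraph n by <:].

Lemma empty_subproof n : @is_simple_graph n [ffun=> false].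
Proof.
apply/andP; split; first by apply/forallP => i; rewrite ffunE.
by apply/forallP => i; apply/forallP => j; rewrite !ffunE.
Qed.

Definition empty_graph n : sgraph n := SGraph (empty_subproof n).

Lemma compl_subproof n (G : sgraph n) :
  @is_simple_graph n [ffun p => (p.1 != p.2) && ~~ G p].
Proof.
have /andP[_ /forallP symG] := edgesP G.
apply/andP; split; first by apply/forallP => i; rewrite ffunE /= eqxx.
apply/forallP => i; apply/forallP => j; rewrite !ffunE /=.
by rewrite [i == j]eq_sym (eqP (forallP (symG i) j)).
Qed.

Definition compl n (G : sgraph n) : sgraph n := SGraph (compl_subproof G).

Definition adjacency (R : realType) n (G : sgraph n) : 'M[R]_n :=
  \matrix_(i, j) (G (i, j))%:R.

(* The eigenvalues with algebraic multiplicity, in nonincreasing order. Such a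
   sequence is unique when it exists, and it exists for symmetric matrices:
   see spectrumP. *)
Definition is_spectrum (R : realType) n (A : 'M[R]_n) (s : seq R) : Prop :=
  sorted >=%R s /\ char_poly A = \prod_(x <- s) ('X - x%:P).

Definition spectrum (R : realType) n (A : 'M[R]_n) : seq R :=
  xget [::] [set s | is_spectrum A s].

Lemma spectrumP (R : realType) n (A : 'M[R]_n) :
  A^T = A -> is_spectrum A (spectrum A).
Proof.
move=> symA; pose f := real_complex R; pose B := map_mx f A.
have hermB : B \is hermsymmx.
  apply/is_hermitianmxP; rewrite expr0 scale1r.
  apply/matrixP => i j; rewrite !mxE -[in LHS]symA mxE.
  by apply/esym/conj_Creal/complex_realP; exists (A j i).
have /orthomx_spectralP specB := hermitian_normalmx hermB.
pose D := spectral_diag B.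
have realD i : exists x : R, D 0 i = f x.
  apply/complex_realP; have := hermitian_spectral_diag_real hermB.
  by move=> /mxOverP; apply.
pose d i := sval (cid (realD i)).
have dE i : D 0 i = f (d i) by rewrite /d; case: cid.
pose s := [seq d i | i <- enum 'I_n].
have charA : char_poly A = \prod_(x <- s) ('X - x%:P).
  apply: (map_poly_inj f); rewrite map_char_poly -/B.
  have -> : char_poly B = char_poly (diag_mx D).
    rewrite /char_poly.
    have P_unit := spectral_unit B.
    pose P := map_mx (@polyC R[i]) (spectralmx B).
    pose P' := map_mx (@polyC R[i]) (invmx (spectralmx B)).
    have P'P : P' *m P = 1%:M by rewrite -map_mxM mulVmx // map_mx1.
    have -> : char_poly_mx B = P' *m char_poly_mx (diag_mx D) *m P.
      rewrite /char_poly_mx mulmxBr mulmxBl [in LHS]specB !map_mxM -/P -/P'.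
      by rewrite -/D -scalemx1 -scalemxAr mulmx1 -scalemxAl P'P.
    by rewrite det_mulmx det_mulmx mulrAC -det_mulmx P'P det1 mul1r.
  rewrite char_poly_trig ?diag_mx_is_trig // rmorph_prod big_map big_enum /=.
  apply: eq_bigr => i _.
  by rewrite rmorphB /= map_polyX map_polyC /= mxE eqxx mulr1n dE.
apply: (@xgetPex _ [::] [set s | is_spectrum A s]).
exists (sort >=%R s); split; first by apply: sort_sorted => x y; exact: ge_total.
by rewrite charA; apply: perm_big; rewrite perm_sym perm_sort.
Qed.

(* The k-th largest adjacency eigenvalue, numbered from k = 1; only the values
   with 1 <= k <= n are meaningful. *)
Definition lambda (R : realType) n (k : nat) (G : sgraph n) : R :=
  (spectrum (adjacency R G))`_k.-1.

(* Minimum over all graphs on n vertices; the initial value of the iterated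
   minimum is itself attained, at the empty graph. *)
Definition min_graph (R : realType) n (f : sgraph n -> R) : R :=
  \big[Order.min/f (empty_graph n)]_(G : sgraph n) f G.

Definition beta (R : realType) (i j : nat) : R :=
  limn (fun n : nat => n%:R^-1 *
    min_graph (fun G : sgraph n =>
      lambda R (n - i + 1)%N G + lambda R (n - j + 1)%N (compl G)) : R).

Definition hadamard (R : realType) m (H : 'M[R]_m) : Prop :=
  (forall i j, H i j = 1 \/ H i j = -1) /\ H *m H^T = m%:R%:M.

(* Main.v *)
(* Write [mu A] for the k-th smallest eigenvalue of A, let A and B be the
   adjacency matrices of G and its complement, and S = A - B, so that
   2A = J - I + S and 2B = J - I - S.

   Lower bound: let P and Q project onto eigenvectors of the k smallest
   eigenvalues of A and B. Since J is positive semidefinite,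
   tr S(Q - P) >= - 2k (mu A + mu B) - 2k, while Cauchy-Schwarz for the
   Frobenius norm gives tr S(Q - P) <= n sqrt(2k), because tr PQ >= 0. Hence
   mu A + mu B >= - n / sqrt(2k) - 1.

   Sharpness: it suffices to have a symmetric sign matrix S of order N with
   zero row sums, zero trace, and S^3 = c^2 S, where N = c sqrt(2k). Its nonzero
   eigenvalues are c and -c, k times each, with eigenvectors orthogonal to the
   all-ones vector, and blowing up the vertices of S gives graphs attaining the
   bound asymptotically. If H is a symmetric Hadamard matrix of order 2k and
   trace 0, take the Kronecker product of H and [[1, -1], [-1, 1]]. If tr H is
   nonzero, this fails because the two eigenvalues of H have different
   multiplicities; but tr H is then a nonzero integer multiple of sqrt(2k), so
   2k = r^2 is an even square, and a kernel exists without using H: on pairs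
   (a, x) with a < r and x in {0,1}^r put
   S((a, x), (b, y)) = +-(-1)^(x_b) (-1)^(y_a), which up to signs and the factor
   c = 2^r exchanges the orthogonal vectors e_a (x) chi_b and e_b (x) chi_a. *)
Require Import Defs.
From HB Require Import structures.
From mathcomp Require Import all_boot all_order all_algebra.
From mathcomp Require Import perm complex ring lra zify.
From mathcomp Require Import all_classical all_reals all_analysis.
Set Implicit Arguments.
Unset Strict Implicit.
Unset Printing Implicit Defensive.
Import Order.TTheory GRing.Theory Num.Theory.
Import numFieldNormedType.Exports.
Local Open Scope classical_set_scope.
Local Open Scope ring_scope.
Local Open Scope sesquilinear_scope.

Local Notation toC R := (real_complex R).

(** * Spectra of real symmetric matrices *)

(** In a full-rank factorization P = CB of an idempotent, cancelling C and B in CBCB = CB leaves BC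
    = 1, and tr CB = tr BC. *)
Lemma mxrank_idem (F : fieldType) n (P : 'M[F]_n) :
  P *m P = P -> \tr P = (\rank P)%:R.
Proof.
move=> PP.
have := mulmx_base P; have := row_base_free P; have := col_base_full P.
move: (col_base P) (row_base P) => C B fullC freeB CB.
have BC : B *m C = 1%:M.
  apply: (row_free_inj freeB); apply: (row_full_inj fullC).
  by rewrite mul1mx CB !mulmxA CB -mulmxA CB.
by rewrite -[X in \tr X]CB mxtrace_mulC BC mxtrace1.
Qed.

(** The spectral theorem yields the eigenvalues in an unknown order. By the characteristic
    polynomial they are a permutation of [spectrum A], and permuting the rows of the eigenbasis
    sorts them. *)
Lemma symmetric_spectral (R : realType) n (A : 'M[R]_n) : A^T = A ->
  exists2 U : 'M[R[i]]_n, U \is unitarymx &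
    map_mx (toC R) A =
      U^t* *m diag_mx (\row_i (toC R (spectrum A)`_i)) *m U.
Proof.
move=> symA; pose f := toC R; pose B := map_mx f A.
have [_ charA] := spectrumP symA; set s := spectrum A in charA *.
have hermB : B \is hermsymmx.
  apply/is_hermitianmxP; rewrite expr0 scale1r.
  apply/matrixP => i j; rewrite !mxE -[in LHS]symA mxE.
  by apply/esym/conj_Creal/complex_realP; exists (A j i).
have /orthomx_spectralP specB := hermitian_normalmx hermB.
have UU := spectral_unitarymx B.
set U := spectralmx B in specB UU; set D := spectral_diag B in specB.
rewrite invmx_unitary// in specB.
have charB :
    char_poly B = \prod_(x <- [seq D 0 i | i <- enum 'I_n]) ('X - x%:P).
  have UU' : U^t* *m U = 1%:M by apply: mulmx1C; apply/unitarymxP.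
  have -> : char_poly B = char_poly (diag_mx D).
    rewrite /char_poly.
    pose P := map_mx (@polyC R[i]) U; pose P' := map_mx (@polyC R[i]) (U^t*).
    have P'P : P' *m P = 1%:M by rewrite -map_mxM UU' map_mx1.
    have -> : char_poly_mx B = P' *m char_poly_mx (diag_mx D) *m P.
      rewrite /char_poly_mx mulmxBr mulmxBl [in LHS]specB !map_mxM.
      by rewrite -scalemx1 -scalemxAr mulmx1 -scalemxAl P'P.
    by rewrite det_mulmx det_mulmx mulrAC -det_mulmx P'P det1 mul1r.
  rewrite char_poly_trig ?diag_mx_is_trig// big_map big_enum /=.
  by apply: eq_bigr => i _; rewrite mxE eqxx mulr1n.
have perm_s : perm_eq [seq f x | x <- s] [seq D 0 i | i <- enum 'I_n].
  apply: prod_XsubC_eq; rewrite -charB -map_char_poly charA rmorph_prod big_map.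
  by apply: eq_bigr => x _; rewrite rmorphB /= map_polyX map_polyC.
have sz : size s = n.
  by have := perm_size perm_s; rewrite size_map size_map size_enum_ord.
have sz' : size [seq f x | x <- s] == n by rewrite size_map sz.
have : perm_eq (Tuple sz') (map_tuple (D 0) (ord_tuple n)) by [].
case/tuple_permP => p ps.
have sE (i : 'I_n) : f s`_i = D 0 (p i).
  have -> : f s`_i = nth 0 (Tuple sz') i by rewrite /= (nth_map 0) ?sz.
  by rewrite ps -tnth_nth tnth_mktuple tnth_map tnth_ord_tuple.
exists (row_perm p U).
  apply/unitarymxP/matrixP => i j.
  have /unitarymxP/matrixP/(_ (p i) (p j)) := UU.
  rewrite !mxE (inj_eq perm_inj) => <-.
  by apply: eq_bigr => l _; rewrite !mxE.
rewrite [LHS]specB; apply/matrixP => a b; rewrite !mxE.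
rewrite (reindex_inj (@perm_inj _ p)) /=; apply: eq_bigr => i _.
by rewrite !mul_mx_diag !mxE -[toC R _]/(f s`_i) sE.
Qed.

Lemma size_spectrum (R : realType) n (A : 'M[R]_n) :
  A^T = A -> size (spectrum A) = n.
Proof.
move=> /spectrumP[_ charA]; have := size_char_poly A.
by rewrite charA size_prod_XsubC => -[].
Qed.

Lemma spectrum_nonincreasing (R : realType) n (A : 'M[R]_n) i j :
  A^T = A -> (i <= j < n)%N -> (spectrum A)`_j <= (spectrum A)`_i.
Proof.
move=> symA /andP[ij jn]; have [sA _] := spectrumP symA.
have tr : transitive (>=%R : rel R).
  by move=> a b c ba ac; apply: le_trans ac ba.
by apply: (sorted_leq_nth tr lexx 0 sA) => //;
  rewrite inE size_spectrum // (leq_ltn_trans ij).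
Qed.

Lemma mulmx_adj_row (C : numClosedFieldType) n (z : 'rV[C]_n) :
  (z *m z^t*) 0 0 = \sum_i `|z 0 i| ^+ 2.
Proof. by rewrite mxE; apply: eq_bigr => i _; rewrite !mxE normCK. Qed.

Lemma mulmx_diag_adj_row (C : numClosedFieldType) n (z d : 'rV[C]_n) :
  (z *m diag_mx d *m z^t*) 0 0 = \sum_i d 0 i * `|z 0 i| ^+ 2.
Proof.
rewrite mul_mx_diag mxE; apply: eq_bigr => i _.
by rewrite !mxE normCK mulrCA mulrA.
Qed.

Lemma diag_pred_idem (F : fieldType) n (p : pred 'I_n)
    (E := diag_mx (\row_i (p i)%:R) : 'M[F]_n) : E *m E = E.
Proof.
by rewrite mulmx_diag; congr diag_mx; apply/rowP => i;
  rewrite !mxE -natrM mulnb andbb.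
Qed.

Lemma diag_pred_trace (F : fieldType) n (p : pred 'I_n) :
  \tr (diag_mx (\row_i (p i)%:R) : 'M[F]_n) = #|p|%:R.
Proof.
rewrite mxtrace_diag -sum1_card natr_sum [RHS]big_mkcond /=.
by apply: eq_bigr => i _; rewrite mxE unfold_in; case: (p i).
Qed.

Lemma card_ord_lt n m : (m <= n)%N -> #|[pred i : 'I_n | (i < m)%N]| = m.
Proof.
move=> mn; rewrite -sum1_card -(big_ord_widen n (fun=> 1%N))//.
by rewrite sum1_card card_ord.
Qed.

(* The easy half of the Courant-Fischer principle. *)
Lemma spectrum_le (R : realType) n m k (A : 'M[R]_n) (X : 'M[R[i]]_(m, n))
    (mu : R) : A^T = A -> (0 < k)%N -> (k <= \rank X)%N ->
  (forall y : 'rV_n, (y <= X)%MS ->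
    (y *m map_mx (toC R) A *m y^t*) 0 0 <= toC R mu * (y *m y^t*) 0 0) ->
  (spectrum A)`_(n - k) <= mu.
Proof.
move=> symA k0 kX leA; have kn : (k <= n)%N := leq_trans kX (rank_leq_col X).
rewrite leNgt; apply/negP => lt_mu.
have [U UU AE] := symmetric_spectral symA.
pose p (i : 'I_n) := (i <= n - k)%N.
pose E : 'M[R[i]]_n := diag_mx (\row_i (p i)%:R).
have rkE : \rank (E *m U) = (n - k).+1.
  rewrite mxrankMfree; last by rewrite row_free_unit unitarymx_unit.
  apply/eqP; rewrite -(eqr_nat R[i]) -mxrank_idem ?diag_pred_idem//.
  rewrite diag_pred_trace; apply/eqP; congr _%:R.
  have lt_nk : ((n - k).+1 <= n)%N by rewrite ltn_subrL k0 (leq_trans k0).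
  by rewrite -[RHS](card_ord_lt lt_nk); apply: eq_card => i; rewrite !inE.
(* The indices up to n - k give n - k + 1 eigenvectors, so their span meets the row space of [X], of
   rank at least k, nontrivially. *)
have : (X :&: E *m U)%MS != 0.
  rewrite -mxrank_eq0 -lt0n -(ltn_add2l (\rank (X + E *m U))) addn0.
  rewrite mxrank_sum_cap rkE (leq_ltn_trans (rank_leq_col _))//.
  by move: kX kn; clear; lia.
case/rowV0Pn => y; rewrite sub_capmx => /andP[yX /submxP[w yE]] y0.
pose z := w *m E; have yz : y = z *m U by rewrite yE mulmxA.
have z0 : z != 0 by apply: contra y0 => /eqP z0; rewrite yz z0 mul0mx.
have := leA y yX; rewrite AE yz trmx_mul map_mxM !mulmxA.
rewrite !(mulmxtVK _ UU) mulmx_diag_adj_row mulmx_adj_row.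
rewrite mulr_sumr -subr_ge0 -sumrB => sum_ge0.
pose F (i : 'I_n) := (toC R (spectrum A)`_i - toC R mu) * `|z 0 i| ^+ 2.
have zp i : ~~ p i -> z 0 i = 0.
  by move=> /negPf np; rewrite /z mul_mx_diag !mxE np mulr0.
have Fpos i : p i -> 0 < toC R (spectrum A)`_i - toC R mu.
  move=> ip; rewrite subr_gt0 ltcR (lt_le_trans lt_mu)//.
  apply: spectrum_nonincreasing => //; apply/andP; split; first exact: ip.
  by rewrite ltn_subrL k0 (leq_trans k0).
have F0 i : 0 <= F i.
  have [/Fpos/ltW Fi|/zp Fi] := boolP (p i);
    last by rewrite /F Fi normr0 expr0n mulr0.
  by rewrite mulr_ge0 ?exprn_ge0.
(* On the common vector the form of A - mu is at most 0, yet a sum of nonnegative terms; hence every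
   coordinate vanishes. *)
have sF : \sum_i F i = 0.
  apply/le_anti; rewrite sumr_ge0// andbT -oppr_ge0.
  rewrite -sumrN; apply: (le_trans sum_ge0).
  rewrite le_eqVlt; apply/orP; left; apply/eqP.
  by apply: eq_bigr => i _; rewrite /F mulrBl opprB [(\row__ _) _ _]mxE.
move: z0 => /negP; apply; apply/eqP/rowP => i; rewrite [RHS]mxE.
have [ip|/zp//] := boolP (p i).
have /eqP : F i = 0 by apply: (psumr_eq0P _ sF).
by rewrite mulf_eq0 gt_eqF ?Fpos//= expf_eq0 normr_eq0 => /eqP.
Qed.

(** Project onto the eigenvectors of the last k indices: the trace against [A] is the sum of the k
    smallest eigenvalues, the largest of which has 0-based index n - k. *)
Lemma bottom_projection (R : realType) n k (A : 'M[R]_n) :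
  A^T = A -> (0 < k <= n)%N ->
  exists P : 'M[R[i]]_n, [/\ P^t* = P, P *m P = P, \tr P = k%:R &
    \tr (map_mx (toC R) A *m P) <= k%:R * toC R (spectrum A)`_(n - k)].
Proof.
move=> symA /andP[k0 kn]; have [U UU AE] := symmetric_spectral symA.
pose p (i : 'I_n) := (n - k <= i)%N.
pose E : 'M[R[i]]_n := diag_mx (\row_i (p i)%:R).
have EE : E *m E = E by exact: diag_pred_idem.
have cardp : #|p| = k.
  apply: (@addIn (n - k)%N); rewrite -{1}(card_ord_lt (leq_subr k n)) subnKC//.
  rewrite -[RHS]card_ord -(cardC p); congr (_ + _)%N; apply: eq_card => i.
  by rewrite !inE -ltnNge.
have EC : E^t* = E.
  rewrite tr_diag_mx map_diag_mx; congr diag_mx; apply/rowP => i.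
  by rewrite !mxE; exact: rmorph_nat.
exists (U^t* *m E *m U); split.
- by rewrite !trmx_mul !map_mxM trmxCK EC mulmxA.
- by rewrite !mulmxA (mulmxtVK _ UU) -[_ *m E *m E]mulmxA EE.
- rewrite mxtrace_mulC mulmxA (unitarymxP UU) mul1mx diag_pred_trace.
  by congr _%:R.
rewrite AE !mulmxA (mulmxtVK _ UU) mxtrace_mulC !mulmxA (unitarymxP UU) mul1mx.
have kE : k%:R = \sum_(i | p i) 1 :> R[i].
  by rewrite -[in LHS]cardp -sum1_card natr_sum.
rewrite mulmx_diag mxtrace_diag kE mulr_suml [leRHS]big_mkcond /=.
apply: ler_sum => i _; rewrite !mxE.
case: (boolP (p i)) => ip; last by rewrite mulr0.
rewrite mulr1 mul1r lecR; apply: spectrum_nonincreasing => //.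
by apply/andP; split; [exact: ip | exact: ltn_ord].
Qed.

(** * Lower bound *)

Lemma adjacency_sym (R : realType) n (G : sgraph n) :
  (adjacency R G)^T = adjacency R G.
Proof.
apply/matrixP => i j; rewrite !mxE; congr (nat_of_bool _)%:R.
by have /andP[_ /forallP/(_ j)/forallP/(_ i)/eqP] := edgesP G.
Qed.

Lemma adjacency_compl (R : realType) n (G : sgraph n) :
  adjacency R (compl G) = const_mx 1 - 1%:M - adjacency R G.
Proof.
apply/matrixP => i j; rewrite !mxE ffunE /=.
have [<-|] := eqVneq i j; last by case: (G _) => _ /=; rewrite ?subr0 ?subrr.
have /andP[/forallP/(_ i)/negPf -> _] := edgesP G.
by rewrite subrr subr0.
Qed.

(** * Positivity of traces *)

Lemma mxtrace_mul_adj_ge0 (C : numClosedFieldType) m n (X : 'M[C]_(m, n)) :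
  0 <= \tr (X *m X^t*).
Proof.
apply: sumr_ge0 => i _; rewrite mxE; apply: sumr_ge0 => j _.
by rewrite !mxE mul_conjC_ge0.
Qed.

Lemma adjmxD (C : numClosedFieldType) m n (X Y : 'M[C]_(m, n)) :
  (X + Y)^t* = X^t* + Y^t*.
Proof. by apply/matrixP => i j; rewrite !mxE rmorphD. Qed.

Lemma adjmxB (C : numClosedFieldType) m n (X Y : 'M[C]_(m, n)) :
  (X - Y)^t* = X^t* - Y^t*.
Proof. by apply/matrixP => i j; rewrite !mxE rmorphB. Qed.

Lemma adjmxZ (R : realType) m n a (X : 'M[R[i]]_(m, n)) :
  (toC R a *: X)^t* = toC R a *: X^t*.
Proof.
apply/matrixP => i j; rewrite !mxE rmorphM; congr (_ * _); exact: conjc_real.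
Qed.

Lemma complexRe_nat (R : realType) m : complex.Re (m%:R : R[i]) = m%:R.
Proof. by rewrite -(rmorph_nat (toC R)). Qed.

Definition Retr (R : realType) n (X : 'M[R[i]]_n) : R := complex.Re (\tr X).

Lemma RetrD (R : realType) n (X Y : 'M[R[i]]_n) :
  Retr (X + Y) = Retr X + Retr Y.
Proof. by rewrite /Retr raddfD raddfD. Qed.

Lemma RetrB (R : realType) n (X Y : 'M[R[i]]_n) :
  Retr (X - Y) = Retr X - Retr Y.
Proof. by rewrite /Retr raddfB raddfB. Qed.

Lemma RetrZ (R : realType) n (a : R) (X : 'M[R[i]]_n) :
  Retr (toC R a *: X) = a * Retr X.
Proof.
by rewrite /Retr mxtraceZ; case: (\tr X) => x y /=; rewrite mul0r subr0.
Qed.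

Lemma RetrC (R : realType) n (X Y : 'M[R[i]]_n) : Retr (X *m Y) = Retr (Y *m X).
Proof. by rewrite /Retr mxtrace_mulC. Qed.

Lemma le_Re (R : realType) (x y : R[i]) :
  x <= y -> complex.Re x <= complex.Re y.
Proof. by rewrite lecE => /andP[]. Qed.

Lemma Retr_mul_adj_ge0 (R : realType) m n (X : 'M[R[i]]_(m, n)) :
  0 <= Retr (X *m X^t*).
Proof. exact: (le_Re (mxtrace_mul_adj_ge0 X)). Qed.

(** Idempotence and cyclicity turn tr PQ into tr (QP)(QP)^*. *)
Lemma Retr_mul_proj_ge0 (R : realType) n (P Q : 'M[R[i]]_n) :
  P^t* = P -> P *m P = P -> Q^t* = Q -> Q *m Q = Q -> 0 <= Retr (P *m Q).
Proof.
move=> PC PP QC QQ; rewrite -{1}PP -{1}QQ mulmxA RetrC !mulmxA.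
rewrite -[_ *m P *m Q]mulmxA.
by have := Retr_mul_adj_ge0 (Q *m P); rewrite trmx_mul map_mxM PC QC.
Qed.

(** For the all-ones column o, J = o o^* and so tr JP = |Po|^2. *)
Lemma Retr_const_mul_proj_ge0 (R : realType) n (P : 'M[R[i]]_n) :
  P^t* = P -> P *m P = P -> 0 <= Retr (const_mx 1 *m P).
Proof.
move=> PC PP; pose o : 'cV[R[i]]_n := const_mx 1.
have -> : const_mx 1 = o *m o^t* :> 'M[R[i]]_n.
  by apply/matrixP => i j; rewrite !mxE big_ord1 !mxE mul1r; apply/esym/rmorph1.
rewrite -{1}PP mulmxA RetrC !mulmxA -[_ *m o^t* *m P]mulmxA.
by have := Retr_mul_adj_ge0 (P *m o); rewrite trmx_mul map_mxM PC.
Qed.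

(** The real arithmetic that ends the lower bound. Two-letter variables are traces of the products
    they spell, [b] and [a] are the eigenvalues of the graph and its complement, and the last
    hypothesis is tr M^2 >= 0 for M = S - t(Q - P), where tr (Q - P)^2 = 2k - 2 tr PQ. *)
Lemma frobenius_bound (F : realFieldType)
    (k t a b ap aq jp jq pq sp sq ss : F) :
  0 < k -> 0 < t -> 0 <= pq -> 0 <= jp -> 0 <= jq ->
  sp = 2 * ap + k - jp -> sq = 2 * aq + k - jq ->
  ap <= k * b -> jq - k - aq <= k * a -> ss <= t ^+ 2 * (2 * k) ->
  0 <= ss - t * (sq - sp) - (t * (sq - sp) - t * (t * (k - pq - (pq - k)))) ->
  - t - 1 <= b + a.
Proof.
move=> k0 t0 pq0 jp0 jq0 spE sqE ap_le aq_le ss_le ge0.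
have tpq : 0 <= t * t * pq by rewrite !mulr_ge0// ltW.
have le_t : sq - sp <= 2 * k * t by rewrite -(ler_pM2l t0); lra.
suff : k * 0 <= k * (t + 1 + a + b) by rewrite ler_pM2l//; lra.
by rewrite spE sqE in le_t; lra.
Qed.

Lemma lambda_sum_ge (R : realType) n k (G : sgraph n) : (0 < k <= n)%N ->
  - (n%:R / Num.sqrt (2 * k)%:R) - 1 <=
  lambda R (n - k + 1) G + lambda R (n - k + 1) (compl G).
Proof.
move=> kn; have /andP[k0 kn'] := kn; rewrite /lambda addn1 /=.
have [P [PC PP tP leP]] := bottom_projection (adjacency_sym R G) kn.
have [Q [QC QQ tQ leQ]] := bottom_projection (adjacency_sym R (compl G)) kn.
move: (spectrum _)`_ _ (spectrum _)`_ _ leP leQ => a b.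
rewrite adjacency_compl; set A := adjacency R G.
pose J : 'M[R[i]]_n := const_mx 1.
have toCk x : k%:R * toC R x = toC R (k%:R * x) by rewrite rmorphM rmorph_nat.
have -> : map_mx (toC R) (const_mx 1 - 1%:M - A) = J - 1%:M - map_mx (toC R) A.
  by rewrite !map_mxB map_const_mx map_mx1 rmorph1.
set AC := map_mx _ A; rewrite !toCk => /le_Re leP /le_Re leQ.
have AH : AC^t* = AC.
  rewrite /AC map_trmx [A^T]adjacency_sym; apply/matrixP => i j; rewrite !mxE;
    apply: conjc_real.
have JH : J^t* = J.
  by rewrite trmx_const map_const_mx; congr const_mx; exact: rmorph1.
have H1 : (1%:M : 'M[R[i]]_n)^t* = 1%:M by rewrite trmx1 map_mx1.
(* This is A - B: zero on the diagonal and signs elsewhere, whence tr S^2 <= n^2. *)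
pose S := AC + AC + 1%:M - J.
have SH : S^t* = S by rewrite /S adjmxB !adjmxD AH JH H1.
have SS : Retr (S *m S) <= n%:R ^+ 2.
  rewrite -{2}SH /Retr;
    apply: (@le_trans _ _ (complex.Re (\sum_(i < n) \sum_(j < n) 1 : R[i]))).
    apply: le_Re; apply: ler_sum => i _; rewrite mxE; apply: ler_sum => j _.
    rewrite !mxE -normCK.
    have /andP[/forallP/(_ i)/negPf Gii _] := edgesP G.
    have [<-|_] := eqVneq i j.
      by rewrite Gii rmorph0 !add0r subrr normr0 expr0n ler01.
    case: (G _); rewrite ?(rmorph0, rmorph1) ?addr0 ?addrK ?add0r ?normrN;
      by rewrite normr1 expr1n.
  by rewrite !sumr_const !card_ord -[_ *+ n]mulr_natr -natrM complexRe_nat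
    natrM expr2.
have JP := Retr_const_mul_proj_ge0 PC PP.
have JQ := Retr_const_mul_proj_ge0 QC QQ.
have PQ := Retr_mul_proj_ge0 PC PP QC QQ.
have rP : Retr P = k%:R by rewrite /Retr tP complexRe_nat.
have rQ : Retr Q = k%:R by rewrite /Retr tQ complexRe_nat.
have SP : Retr (S *m P) = 2 * Retr (AC *m P) + k%:R - Retr (J *m P).
  by rewrite /S mulmxBl !mulmxDl mul1mx RetrB !RetrD rP; ring.
have BQ : Retr ((J - 1%:M - AC) *m Q) = Retr (J *m Q) - k%:R - Retr (AC *m Q).
  by rewrite !mulmxBl mul1mx !RetrB rQ.
have SQ : Retr (S *m Q) = 2 * Retr (AC *m Q) + k%:R - Retr (J *m Q).
  by rewrite /S mulmxBl !mulmxDl mul1mx RetrB !RetrD rQ; ring.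
(* The quotient of the norm bounds n for S and sqrt(2k) for Q - P. *)
set t := n%:R / Num.sqrt (2 * k)%:R.
clearbody S.
(* Cauchy-Schwarz for S and Q - P, as the nonnegativity of tr M^2. *)
pose M := S - toC R t *: (Q - P).
have MH : M^t* = M.
  by rewrite /M adjmxB SH adjmxZ adjmxB PC QC.
have := Retr_mul_adj_ge0 M; rewrite MH.
rewrite /M mulmxBl !mulmxBr -!scalemxAl -!scalemxAr !mulmxBl !mulmxBr PP QQ.
rewrite !(RetrB, RetrZ) rP rQ.
rewrite [Retr (P *m S)]RetrC [Retr (Q *m S)]RetrC [Retr (Q *m P)]RetrC.
have k2 : 0 < (2 * k)%:R :> R by rewrite ltr0n muln_gt0.
have s2 : 0 < Num.sqrt (2 * k)%:R :> R by rewrite sqrtr_gt0.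
have t0 : 0 < t by rewrite divr_gt0// ltr0n (leq_trans k0).
have t2 : t ^+ 2 * (2 * k)%:R = n%:R ^+ 2.
  by rewrite /t expr_div_n sqr_sqrtr ?ltW// divfK// gt_eqF.
have leP' : Retr (AC *m P) <= k%:R * b := leP.
have leQ' : Retr ((J - 1%:M - AC) *m Q) <= k%:R * a := leQ.
rewrite natrM in t2; rewrite BQ in leQ'; rewrite -t2 in SS.
have k1 : 0 < k%:R :> R by rewrite ltr0n.
exact: (frobenius_bound k1 t0 PQ JP JQ SP SQ leP' leQ' SS).
Qed.

(** * Upper bounds *)

Lemma mulmx_adj_row_ge0 (C : numClosedFieldType) n (y : 'rV[C]_n) :
  0 <= (y *m y^t*) 0 0.
Proof. by rewrite mulmx_adj_row sumr_ge0// => i _; rewrite exprn_ge0. Qed.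

Lemma lambda_le (R : realType) n m k (G : sgraph n) (X : 'M[R]_(m, n))
    (mu : R) :
  (0 < k)%N -> (k <= \rank X)%N ->
  (forall y : 'rV[R[i]]_n, (y <= map_mx (toC R) X)%MS ->
    (y *m map_mx (toC R) (adjacency R G) *m y^t*) 0 0 <=
      toC R mu * (y *m y^t*) 0 0) ->
  lambda R (n - k + 1) G <= mu.
Proof.
move=> k0 kX leG; rewrite /lambda addn1 /=.
apply: (spectrum_le (adjacency_sym R G) k0 _ leG).
by rewrite mxrank_map.
Qed.

Lemma mul_const1_mx (S : pzSemiRingType) m n (y : 'M[S]_(m, n)) p :
  y *m (const_mx 1 : 'cV_n) = 0 -> y *m (const_mx 1 : 'M[S]_(n, p)) = 0.
Proof.
move=> /matrixP y1; apply/matrixP => i j; have := y1 i 0.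
by rewrite !mxE => y10; rewrite -[RHS]y10; apply: eq_bigr => l _; rewrite !mxE.
Qed.

(** A test graph showing that the minimum is at most 0. The complement has matrix J - I, which is -I
    on the vectors orthogonal to the all-ones vector; they have dimension n - 1, hence the strict k
    < n. *)
Lemma lambda_empty_le0 (R : realType) n k : (0 < k < n)%N ->
  lambda R (n - k + 1) (empty_graph n) <= 0 /\
  lambda R (n - k + 1) (compl (empty_graph n)) <= 0.
Proof.
case/andP => k0 kn.
have A0 : adjacency R (empty_graph n) = 0.
  by apply/matrixP => i j; rewrite !mxE ffunE.
split.
  apply: (@lambda_le _ _ n k _ 1%:M) => //; first by rewrite mxrank1 ltnW.
  by move=> y _; rewrite A0 map_mx0 mulmx0 mul0mx mxE rmorph0 mul0r.
pose o : 'cV[R]_n := const_mx 1.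
apply: (@lambda_le _ _ n k _ (kermx o)) => //.
  rewrite mxrank_ker; apply: leq_trans (leq_sub2l n (rank_leq_col o)).
  by rewrite -ltnS subn1 prednK // (leq_trans _ kn).
move=> y; rewrite map_kermx => /sub_kermxP y1.
rewrite adjacency_compl A0 subr0 map_mxB map_mx1 map_const_mx rmorph1.
rewrite mulmxBr mulmx1 mul_const1_mx; last first.
  by move: y1; rewrite /o map_const_mx rmorph1.
by rewrite sub0r mulNmx mxE rmorph0 mul0r oppr_le0 mulmx_adj_row_ge0.
Qed.

(** Test vectors are constant on t copies of each vertex of [T] and zero on the leftover vertices.
    For z in the row space of [X], the form of G is at most -(t^2 c / 2)|z|^2 while the squared norm
    is t|z|^2. *)
Lemma lambda_blowup_le (R : realType) (N n t k m : nat) (T : 'M[R]_N.+1)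
    (X : 'M[R]_(m, N.+1)) (c : R) (G : sgraph n) :
  (forall a b, T a b = 1 \/ T a b = -1) ->
  (0 < k <= \rank X)%N ->
  X *m T = - c *: X -> X *m (const_mx 1 : 'cV_N.+1) = 0 ->
  (forall i j, G (i, j) =
    (i != j) && (T (inord (i %% N.+1)) (inord (j %% N.+1)) == 1)) ->
  (0 < t)%N -> (t * N.+1 <= n)%N ->
  lambda R (n - k + 1) G <= - (t%:R * c / 2).
Proof.
move=> T1 /andP[k0 kX] XT X1 GE t0 tn.
have gP (a : 'I_N.+1) (s : 'I_t) : (s * N.+1 + a < n)%N.
  apply: leq_trans tn; rewrite (@leq_trans (s.+1 * N.+1))//.
    by rewrite mulSn addnC ltn_add2r.
  by rewrite leq_mul2r ltn_ord orbT.
(* g a s is the s-th copy of the vertex a in the blow-up. *)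
pose g a s := Ordinal (gP a s).
have fg a s : inord (g a s %% N.+1) = a.
  by rewrite /= modnMDl modn_small// inord_val.
have g_inj a s b s' : (g a s == g b s') = (a == b) && (s == s').
  apply/eqP/andP => [e|[/eqP-> /eqP->]//].
  have ab : a = b by rewrite -(fg a s) e fg.
  rewrite ab; split=> //; apply/eqP/val_inj.
  by move: e => /(congr1 val) /= /eqP; rewrite ab eqn_add2r eqn_mul2r => /eqP.
pose F : 'M[R]_(N.+1, n) := \matrix_(a, i) \sum_s (g a s == i)%:R.
have FE a (h : 'I_n -> R) : \sum_i F a i * h i = \sum_s h (g a s).
  under eq_bigr do rewrite mxE mulr_suml.
  rewrite exchange_big /=; apply: eq_bigr => s _.
  rewrite (bigD1 (g a s))//= eqxx mul1r big1 ?addr0// => i.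
  by rewrite eq_sym => /negPf ->; rewrite mul0r.
have FF : F *m F^T = t%:R%:M.
  apply/matrixP => a b; rewrite !mxE.
  under eq_bigr do rewrite [F^T _ _]mxE; rewrite FE.
  transitivity (\sum_(s < t) (a == b)%:R : R); last first.
    by rewrite sumr_const card_ord; case: (a == b); rewrite ?mul0rn.
  apply: eq_bigr => s _; rewrite mxE (bigD1 s)//= g_inj eqxx andbT eq_sym.
  rewrite big1 ?addr0// => s'; rewrite g_inj.
  by move=> /negPf ->; rewrite andbF.
(* The copies of a are pairwise adjacent when T a a = 1, but no copy has a loop; the diagonal term
   removes these t loops and only lowers the form. *)
have FAF : F *m adjacency R G *m F^T = t%:R ^+ 2 *: (2^-1 *: (const_mx 1 + T)) -
    t%:R *: diag_mx (\row_a (T a a == 1)%:R).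
  apply/matrixP => a b; rewrite [LHS]mxE.
  under eq_bigr do rewrite mulrC [F^T _ _]mxE; rewrite FE.
  under eq_bigr do [rewrite mxE FE; under eq_bigr do rewrite mxE GE !fg g_inj].
  have tau : (T a b == 1)%:R = 2^-1 * (1 + T a b).
    case: (T1 a b) => ->; first by rewrite eqxx mulVf.
    by rewrite subrr mulr0 eqNr oner_eq0.
  rewrite !mxE -tau.
  have [<-|ab] := eqVneq a b.
    set p := (T a a == 1)%:R.
    transitivity (\sum_(i < t) (t%:R * p - p)); last first.
      by rewrite sumr_const card_ord mulr1n expr2 -[LHS]mulr_natl mulrBr mulrA.
    apply: eq_bigr => s _.
    transitivity (\sum_(i < t) (p - (if i == s then p else 0))).
      by apply: eq_bigr => i _; rewrite /p; case: (i == s);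
        rewrite ?subrr ?subr0.
    by rewrite sumrB -big_mkcond big_pred1_eq sumr_const card_ord mulr_natl.
  under eq_bigr do rewrite sumr_const card_ord.
  by rewrite sumr_const card_ord /= mulr0n mulr0 subr0 expr2 -mulrA !mulr_natl.
have FFC : map_mx (toC R) F *m map_mx (toC R) F^T = t%:R%:M.
  by rewrite -map_mxM FF map_scalar_mx rmorph_nat.
apply: (@lambda_le _ _ _ k _ (X *m F)) => //.
  rewrite mxrankMfree//; apply/row_freeP; exists (t%:R^-1 *: F^T).
  by rewrite -scalemxAr FF scale_scalar_mx mulVf// pnatr_eq0 -lt0n.
move=> y /submxP[w]; rewrite map_mxM mulmxA; set z := w *m _ => ->.
have FC : (z *m map_mx (toC R) F)^t* = map_mx (toC R) F^T *m z^t*.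
  rewrite trmx_mul map_mxM; congr (_ *m _); apply/matrixP => i j.
  by rewrite !mxE; apply: conjc_real.
rewrite FC.
have -> : z *m map_mx (toC R) F *m (map_mx (toC R) F^T *m z^t*) =
    t%:R *: (z *m z^t*).
  by rewrite mulmxA -[z *m _ *m _]mulmxA FFC mul_mx_scalar -scalemxAl.
have FAFC :
    map_mx (toC R) F *m map_mx (toC R) (adjacency R G) *m map_mx (toC R) F^T =
    toC R (t%:R ^+ 2) *: (toC R 2^-1 *: (const_mx 1 + map_mx (toC R) T)) -
    toC R t%:R *: diag_mx (\row_a (T a a == 1)%:R).
  rewrite -!map_mxM FAF; apply/matrixP => a b; rewrite !mxE.
  by rewrite rmorphB !rmorphM rmorphD -!mulrnA !rmorph_nat.
have -> : z *m map_mx (toC R) F *m map_mx (toC R) (adjacency R G) *m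
    (map_mx (toC R) F^T *m z^t*) =
    z *m (map_mx (toC R) F *m map_mx (toC R) (adjacency R G) *m
      map_mx (toC R) F^T) *m z^t*.
  by rewrite !mulmxA.
have zT : z *m map_mx (toC R) T = toC R (- c) *: z.
  by rewrite -mulmxA -map_mxM XT map_mxZ scalemxAr.
have zJ : z *m const_mx 1 = 0 :> 'rV_(N.+1).
  apply: mul_const1_mx.
  rewrite -mulmxA; move/(congr1 (map_mx (toC R))): X1.
  by rewrite map_mxM map_const_mx rmorph1 map_mx0 => ->; rewrite mulmx0.
rewrite FAFC mulmxBr -!scalemxAr.
rewrite mulmxDr zJ zT add0r mulmxBl -!scalemxAl.
have leD : 0 <= (z *m diag_mx (\row_a (T a a == 1)%:R) *m z^t*) 0 0.
  rewrite mulmx_diag_adj_row sumr_ge0// => a _.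
  by rewrite mxE mulr_ge0 ?exprn_ge0 ?ler0n.
move: (z *m z^t*) (z *m _ *m _) leD => p q q0; rewrite !mxE.
have -> : toC R (- (t%:R * c / 2)) * (t%:R * p 0 0) =
    toC R (t%:R ^+ 2) * (toC R 2^-1 * (toC R (- c) * p 0 0)).
  rewrite -(rmorph_nat (toC R)) !mulrA -!rmorphM; congr (toC R _ * _); ring.
by rewrite gerBl mulr_ge0// lecR ler0n.
Qed.

Local Close Scope sesquilinear_scope.

Lemma rank_eigenspace_ge (R : realType) n k (T : 'M[R]_n) (c : R) :
  c != 0 -> T *m T *m T = c ^+ 2 *: T -> \tr T = 0 ->
  \tr (T *m T) = c ^+ 2 * (2 * k)%:R -> (k <= \rank (kermx (T + c%:M)))%N.
Proof.
(* E is the projection onto the eigenspace of -c, so its trace is its rank. *)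
move=> c0 T3 tT tTT; pose E := (2 * c ^+ 2)^-1 *: (T *m T - c *: T).
have d0 : 2 * c ^+ 2 != 0 by rewrite mulf_neq0 ?expf_neq0 ?pnatr_eq0.
have EK : (E <= kermx (T + c%:M))%MS.
  apply/sub_kermxP; rewrite -scalemxAl mulmxDr mul_mx_scalar mulmxBl T3.
  rewrite -scalemxAl scalerBr scalerA -expr2.
  by rewrite [X in _ *: X](_ : _ = 0) ?scaler0// addrC subrKA subrr.
suff <- : \rank E = k by exact: mxrankS EK.
(* As T^3 = c^2 T, only the values at 0, c and -c matter; (X^2 - cX) / (2c^2) is 1 at -c and 0 at
   the other two, which makes [E] idempotent. *)
have TT : (T *m T - c *: T) *m (T *m T - c *: T) =
    (2 * c ^+ 2) *: (T *m T - c *: T).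
  rewrite mulmxBl !mulmxBr -!scalemxAr -!scalemxAl mulmxA T3 -!scalemxAl.
  rewrite [T *m (T *m T)]mulmxA T3 !scalerA.
  apply/matrixP => i j; rewrite !mxE; ring.
apply/eqP; rewrite -(eqr_nat R) -mxrank_idem; last first.
  by rewrite -scalemxAl -scalemxAr TT [X in _ *: X]scalerA mulVf// scale1r.
rewrite mxtraceZ raddfB /= mxtraceZ tT mulr0 subr0 tTT.
by apply/eqP; field.
Qed.

(** The matrices S of the sharpness argument, indexed by any finite type since both constructions
    use pairs. The last clause is S^3 = c^2 S. *)
Definition flat_kernel (R : realType) (I : finType) (c : R) (S : I -> I -> R) :
    Prop :=
  [/\ forall x y, S x y = 1 \/ S x y = -1,
      forall x y, S x y = S y x,
      forall x, \sum_y S x y = 0,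
      \sum_x S x x = 0 &
      forall x w, \sum_y S x y * (\sum_z S y z * S z w) = c ^+ 2 * S x w].

(** Complementing the blown-up graph negates its kernel, so this lets one bound serve for both
    graphs. *)
Lemma flat_kernelN (R : realType) (I : finType) (c : R) (S : I -> I -> R) :
  flat_kernel c S -> flat_kernel c (fun x y => - S x y).
Proof.
case=> S1 Sym S0 tS S3; split.
- by move=> x y; case: (S1 x y) => ->; [right|left; rewrite opprK].
- by move=> x y; rewrite Sym.
- by move=> x; rewrite sumrN S0 oppr0.
- by rewrite sumrN tS oppr0.
move=> x w; rewrite mulrN -S3 -sumrN; apply: eq_bigr => y _.
by rewrite mulNr; under eq_bigr do rewrite mulrNN.
Qed.

(** Since T is a symmetric sign matrix, tr T^2 is the squared order, that is 2k c^2; with trace zero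
    this gives -c multiplicity k. *)
Lemma lambda_flat_blowup_le (R : realType) N n t k (T : 'I_N.+1 -> 'I_N.+1 -> R)
    (c : R) (G : sgraph n) :
  flat_kernel c T -> 0 < c -> (0 < k)%N -> N.+1%:R ^+ 2 = c ^+ 2 * (2 * k)%:R ->
  (forall i j, G (i, j) =
    (i != j) && (T (inord (i %% N.+1)) (inord (j %% N.+1)) == 1)) ->
  (0 < t)%N -> (t * N.+1 <= n)%N ->
  lambda R (n - k + 1) G <= - (t%:R * c / 2).
Proof.
move=> [T1 Tsym T0 tT T3] c0 k0 Nc GE tpos tn.
pose M : 'M[R]_N.+1 := \matrix_(a, b) T a b.
have ME a b : M a b = T a b by rewrite mxE.
have M3 : M *m M *m M = c ^+ 2 *: M.
  rewrite -mulmxA; apply/matrixP => a b; rewrite !mxE -T3.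
  apply: eq_bigr => y _.
  by rewrite !mxE; congr (_ * _); apply: eq_bigr => z _; rewrite !mxE.
have tM : \tr M = 0 by rewrite -[RHS]tT; apply: eq_bigr => a _; rewrite mxE.
have tMM : \tr (M *m M) = c ^+ 2 * (2 * k)%:R.
  rewrite -Nc expr2 -natrM /mxtrace.
  transitivity (\sum_(a < N.+1) \sum_(b < N.+1) 1 : R).
    apply: eq_bigr => a _; rewrite mxE; apply: eq_bigr => b _.
    rewrite !mxE [T b a]Tsym; case: (T1 a b) => ->; first by rewrite mul1r.
    by rewrite mulrNN mulr1.
  by rewrite !sumr_const !card_ord -mulrnA.
have kX := rank_eigenspace_ge (lt0r_neq0 c0) M3 tM tMM.
set X := kermx _ in kX.
have XM : X *m M = - c *: X.
  apply/eqP; rewrite scaleNr -addr_eq0 -mul_mx_scalar -mulmxDr.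
  by apply/eqP; exact: mulmx_ker.
apply: (@lambda_blowup_le _ N n t k _ M X) => //.
- by move=> a b; rewrite ME.
- by rewrite k0.
(* T kills the all-ones vector, so eigenvectors for -c, which is nonzero, are orthogonal to it. *)
- have M1 : M *m (const_mx 1 : 'cV_N.+1) = 0.
    apply/matrixP => a b; rewrite !mxE -[RHS](T0 a).
    by apply: eq_bigr => y _; rewrite !mxE mulr1.
  have : X *m M *m (const_mx 1 : 'cV_N.+1) = 0 by rewrite -mulmxA M1 mulmx0.
  rewrite XM -scalemxAl => /eqP; rewrite scaler_eq0 oppr_eq0 gt_eqF//=.
  by move/eqP.
by move=> i j; rewrite ME.
Qed.

Lemma flat_kernel_bij (R : realType) (I J : finType) (h : J -> I) (c : R)
    (S : I -> I -> R) : bijective h ->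
  flat_kernel c S -> flat_kernel c (fun x y => S (h x) (h y)).
Proof.
move=> /onW_bij hbij [S1 Sym S0 tS S3]; split=> //.
- by move=> x; rewrite -[RHS](S0 (h x)) [RHS](reindex h)//; exact: hbij.
- by rewrite -[RHS]tS [RHS](reindex h)//; exact: hbij.
move=> x w; rewrite -S3 [RHS](reindex h)/=; last exact: hbij.
apply: eq_bigr => y _; congr (_ * _).
by rewrite [RHS](reindex h)//; exact: hbij.
Qed.

(** Blow up with t the floor of n / #|I|. The graph and its complement each contribute -tc/2, and t
    #|I| >= n - #|I| with #|I| = c sqrt(2k) bounds the rounding loss. *)
Lemma flat_lambda_sum_le (R : realType) (I : finType) (c : R) (S : I -> I -> R)
    n k :
  flat_kernel c S -> 0 < c -> (0 < k)%N ->
  #|I|%:R = c * Num.sqrt (2 * k)%:R -> (#|I| <= n)%N ->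
  exists G : sgraph n,
    lambda R (n - k + 1) G + lambda R (n - k + 1) (compl G) <=
    - ((n%:R - #|I|%:R) / Num.sqrt (2 * k)%:R).
Proof.
move=> flatS c0 k0 Ic In.
have s0 : 0 < Num.sqrt (2 * k)%:R :> R by rewrite sqrtr_gt0 ltr0n muln_gt0.
have I0 : (0 < #|I|)%N by rewrite -(ltr0n R) Ic mulr_gt0.
case EN : #|I| I0 => [//|N] _; rewrite EN in Ic In.
have [T flatT] : exists T : 'I_N.+1 -> 'I_N.+1 -> R, flat_kernel c T.
  exists (fun a b =>
    S (enum_val (cast_ord (esym EN) a)) (enum_val (cast_ord (esym EN) b))).
  apply: flat_kernel_bij flatS; apply: bij_comp; first exact: enum_val_bij.
  exact: (Bijective (cast_ordK _) (cast_ordKV _)).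
have [T1 Tsym _ _ _] := flatT.
pose f (i : 'I_n) : 'I_N.+1 := inord (i %% N.+1).
pose e : {ffun 'I_n * 'I_n -> bool} :=
  [ffun p => (p.1 != p.2) && (T (f p.1) (f p.2) == 1)].
have eP : is_simple_graph e.
  apply/andP; split; first by apply/forallP => i; rewrite ffunE /= eqxx.
  by apply/forallP => i; apply/forallP => j;
    rewrite !ffunE /= [i == j]eq_sym Tsym.
pose G := SGraph eP; exists G.
have Nc : N.+1%:R ^+ 2 = c ^+ 2 * (2 * k)%:R.
  by rewrite Ic exprMn sqr_sqrtr// ler0n.
pose t := (n %/ N.+1)%N.
have tpos : (0 < t)%N by rewrite divn_gt0.
have tn : (t * N.+1 <= n)%N by rewrite leq_trunc_div.
have GE i j : G (i, j) = (i != j) && (T (f i) (f j) == 1) by rewrite ffunE.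
have cGE i j : compl G (i, j) = (i != j) && (- T (f i) (f j) == 1).
  rewrite !ffunE /=; case: (i != j) => //=.
  have n11 : (-1 == 1 :> R) = false by rewrite eqNr oner_eq0.
  by case: (T1 (f i) (f j)) => ->; rewrite ?opprK eqxx n11.
have le1 := lambda_flat_blowup_le flatT c0 k0 Nc GE tpos tn.
have le2 := lambda_flat_blowup_le (flat_kernelN flatT) c0 k0 Nc cGE tpos tn.
apply: le_trans (lerD le1 le2) _.
rewrite -opprD lerN2 -mulrDl -mulr2n -[_ *+ 2]mulr_natr mulfK ?pnatr_eq0//.
rewrite ler_pdivrMr// -mulrA -Ic lerBlDr -natrM -natrD ler_nat.
by have := ltn_ceil n (ltn0Sn N); rewrite -/t mulSn addnC => /ltnW.
Qed.

(** * Flat kernels *)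

Definition bsign (R : pzRingType) (b : bool) : R := (-1) ^+ b.

Lemma bsignM (R : pzRingType) b : bsign R b * bsign R b = 1.
Proof. by rewrite /bsign -expr2 sqrr_sign. Qed.

Lemma sum_pair (R : nmodType) (I J : finType) (F : I * J -> R) :
  \sum_x F x = \sum_i \sum_j F (i, j).
Proof. by rewrite pair_big /=; apply: eq_bigr => -[]. Qed.

Lemma sum_pair_bool (R : nmodType) (I : finType) (F : I * bool -> R) :
  \sum_x F x = \sum_i (F (i, true) + F (i, false)).
Proof. by rewrite sum_pair; apply: eq_bigr => i _; rewrite big_bool. Qed.

(** For K = [[1, -1], [-1, 1]], K^2 = 2K and H^2 = 2k I give (H (x) K)^3 = 8k H (x) K, which fixes
    c; the row sums vanish because those of K do. *)
Lemma hadamard_flat_kernel (R : realType) k (H : 'M[R]_(2 * k)) :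
  hadamard H -> H^T = H -> \tr H = 0 ->
  flat_kernel (2 * Num.sqrt (2 * k)%:R)
    (fun x y : 'I_(2 * k) * bool => H x.1 y.1 * (bsign R x.2 * bsign R y.2)).
Proof.
move=> [H1 HH] symH tH; rewrite symH in HH.
split.
- move=> [i s] [j t] /=; rewrite /bsign -signr_addb.
  by case: (H1 i j) => ->; case: (s (+) t); rewrite ?mulr1 ?mulrN1 ?opprK; auto.
- by move=> x y; rewrite -[in LHS]symH mxE [bsign R _ * _]mulrC.
- move=> x; rewrite sum_pair_bool big1// => j _ /=.
  by rewrite /bsign expr1 expr0 mulrN1 mulr1 mulrN addNr.
- rewrite sum_pair_bool /=; under eq_bigr do rewrite !bsignM mulr1.
  by rewrite big_split /= -/(\tr H) tH addr0.
have SS (y w : 'I_(2 * k) * bool) :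
    \sum_(z : 'I_(2 * k) * bool) H y.1 z.1 * (bsign R y.2 * bsign R z.2) *
      (H z.1 w.1 * (bsign R z.2 * bsign R w.2)) =
    2 * ((2 * k)%:R *+ (y.1 == w.1)) * (bsign R y.2 * bsign R w.2).
  rewrite sum_pair_bool /=.
  have /matrixP/(_ y.1 w.1) := HH; rewrite !mxE => HHE.
  rewrite -HHE mulr_sumr mulr_suml; apply: eq_bigr => l _.
  by rewrite /bsign expr1 expr0; ring.
move=> x w; under eq_bigr do rewrite SS.
rewrite sum_pair_bool (bigD1 w.1)//= eqxx big1 => [|j /negPf jw]; last first.
  by rewrite jw mulr0n; ring.
by rewrite addr0 exprMn sqr_sqrtr ?ler0n// /bsign expr1 expr0 mulr1n; ring.
Qed.

(** * The Walsh kernel, for 2k a perfect square *)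

Definition flip n (b : 'I_n) (x : {ffun 'I_n -> bool}) :
    {ffun 'I_n -> bool} := [ffun i => (i == b) (+) x i].

Lemma flipK n (b : 'I_n) : involutive (flip b).
Proof. by move=> x; apply/ffunP => i; rewrite !ffunE addKb. Qed.

Lemma sum_flip (R : realType) n (b : 'I_n) (F : {ffun 'I_n -> bool} -> R) :
  (forall x, F (flip b x) = - F x) -> \sum_x F x = 0.
Proof.
move=> Fb; apply/eqP; suff: (\sum_x F x) *+ 2 == 0 by rewrite mulrn_eq0.
rewrite mulr2n {1}(reindex_inj (inv_inj (flipK b))) /= -big_split /=.
by rewrite big1// => x _; rewrite Fb addNr.
Qed.

Lemma sum_bsign_mul (R : realType) n (a b : 'I_n) :
  \sum_(x : {ffun 'I_n -> bool}) bsign R (x a) * bsign R (x b) =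
    2 ^+ n * (a == b)%:R.
Proof.
have [<-|ab] := eqVneq a b.
  under eq_bigr do rewrite bsignM.
  by rewrite sumr_const card_ffun card_bool card_ord mulr1 natrX.
rewrite mulr0; apply: (sum_flip (b := b)) => x.
by rewrite !ffunE eqxx (negPf ab) /= /bsign signrN mulrN.
Qed.

(** [d] marks the diagonal blocks a = b that get the sign -1. Block (a, a) has constant diagonal
    (-1)^(d a), so balanced signs give trace zero. *)
Definition walsh_kernel (R : realType) n (d : pred 'I_n)
    (x y : 'I_n * {ffun 'I_n -> bool}) : R :=
  bsign R ((x.1 == y.1) && d x.1) * (bsign R (x.2 y.1) * bsign R (y.2 x.1)).

Lemma walsh_flat_kernel (R : realType) n (d : pred 'I_n) :
  \sum_a bsign R (d a) = 0 -> flat_kernel (2 ^+ n) (@walsh_kernel R n d).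
Proof.
move=> d0; rewrite /walsh_kernel; split.
- move=> x y; rewrite /bsign -!signr_addb; case: (_ (+) _);
  rewrite ?expr1 ?expr0; auto.
- move=> x y; congr (_ * _); last by rewrite mulrC.
  by rewrite eq_sym; have [->|] := eqVneq.
- move=> x; rewrite sum_pair big1// => b _.
  apply: (sum_flip (b := x.1)) => y; rewrite !ffunE eqxx /= /bsign signrN; ring.
- rewrite sum_pair /=.
  under eq_bigr => a _ do [under eq_bigr do rewrite bsignM mulr1 eqxx /=;
    rewrite sumr_const].
  by rewrite sumrMnl d0 mul0rn.
(* The square of the kernel: orthogonality of the characters leaves only equal first coordinates,
   where the two block signs agree and cancel. *)
have SS (y w : 'I_n * {ffun 'I_n -> bool}) :
    \sum_(z : 'I_n * {ffun 'I_n -> bool})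
    bsign R ((y.1 == z.1) && d y.1) * (bsign R (y.2 z.1) * bsign R (z.2 y.1)) *
    (bsign R ((z.1 == w.1) && d z.1) * (bsign R (z.2 w.1) * bsign R (w.2 z.1)))
    =
    (y.1 == w.1)%:R * 2 ^+ n * \sum_e (bsign R (y.2 e) * bsign R (w.2 e)).
  rewrite sum_pair /=.
  rewrite mulr_sumr; apply: eq_bigr => e _.
  transitivity (bsign R ((y.1 == e) && d y.1) * bsign R ((e == w.1) && d e) *
      (bsign R (y.2 e) * bsign R (w.2 e)) * \sum_(z : {ffun 'I_n -> bool})
        bsign R (z y.1) * bsign R (z w.1)).
    by rewrite mulr_sumr; apply: eq_bigr => z _; ring.
  rewrite sum_bsign_mul; have [->|] := eqVneq y.1 w.1;
    last by rewrite !(mulr0, mul0r).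
  have -> : (w.1 == e) && d w.1 = (e == w.1) && d e.
    by rewrite eq_sym; have [->|] := eqVneq.
  by rewrite bsignM; ring.
move=> x w; under eq_bigr do rewrite SS.
rewrite sum_pair (bigD1 w.1)//= [X in _ + X]big1 => [|b /negPf bw]; last first.
  by apply: big1 => y _; rewrite bw !mul0r mulr0.
rewrite addr0 eqxx mul1r.
(* Summing over y first, orthogonality keeps only e = x.1 and supplies the second factor 2^n. *)
transitivity (\sum_e bsign R ((x.1 == w.1) && d x.1) * bsign R (x.2 w.1) *
    2 ^+ n * bsign R (w.2 e) *
    \sum_(y : {ffun 'I_n -> bool}) bsign R (y x.1) * bsign R (y e)).
  under [RHS]eq_bigr do rewrite mulr_sumr.
  rewrite [RHS]exchange_big /=; apply: eq_bigr => y _.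
  by rewrite !mulr_sumr; apply: eq_bigr => e _; ring.
under eq_bigr do rewrite sum_bsign_mul.
rewrite (bigD1 x.1)//= big1 => [|e /negPf ex]; last first.
  by rewrite [x.1 == e]eq_sym ex !mulr0.
by rewrite eqxx addr0 mulr1 expr2; ring.
Qed.

Lemma hadamard_trace0_or_square (R : realType) k (H : 'M[R]_(2 * k)) :
  (0 < k)%N -> hadamard H -> H^T = H ->
  \tr H = 0 \/ exists r, (2 * k = r ^ 2)%N.
Proof.
move=> k0 [H1 HH] symH; rewrite symH in HH;
  set m := (2 * k)%N in H H1 HH symH *.
(* The rank of the projection E onto the eigenspace of sqrt m is its trace,
   which makes tr H an integer multiple of sqrt m. *)
have m0 : 0 < m%:R :> R by rewrite ltr0n muln_gt0.
pose s : R := Num.sqrt m%:R.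
have s0 : s != 0 by rewrite gt_eqF ?sqrtr_gt0.
have ss : s * s = m%:R by rewrite -expr2 sqr_sqrtr ?ltW.
pose E := (2 * s)^-1 *: (H + s%:M).
have EE : E *m E = E.
  have -> : E *m E = (2 * s)^-1 *: ((2 * s)^-1 *: ((2 * s) *: (H + s%:M))).
    rewrite -scalemxAl -scalemxAr; congr (_ *: (_ *: _)).
    rewrite mulmxDl !mulmxDr HH -scalar_mxM mul_scalar_mx mul_mx_scalar -ss.
    apply/matrixP => i j; rewrite !mxE.
    by case: (i == j); rewrite ?mulr1n ?mulr0n; ring.
  by rewrite scalerK// mulf_neq0 ?pnatr_eq0.
have [z tz] : exists z : int, \tr H = z%:~R.
  exists (\sum_i (if H i i == 1 then 1 else -1)); rewrite rmorph_sum.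
  apply: eq_bigr => i _; case: (H1 i i) => ->; first by rewrite eqxx.
  by rewrite eqNr oner_eq0 rmorphN1.
have := mxrank_idem EE;
  rewrite mxtraceZ raddfD /= mxtrace_scalar tz -[s *+ m]mulr_natr -ss => tE.
pose q : int := (2 * \rank E)%:Z - m%:Z.
(* Solve rank E = tr E = (tr H + m s) / (2s) for tr H, using s^2 = m. *)
have zq : z%:~R = q%:~R * s :> R.
  rewrite /q rmorphB /= -!pmulrn natrM -tE -ss; field.
  by rewrite s0.
have [q0|q0] := eqVneq q 0; first by left; rewrite zq q0 mul0r.
(* Squaring gives z^2 = q^2 m with q nonzero, so q divides z and m is the square of the quotient. *)
right; have : (`|z| ^ 2 = `|q| ^ 2 * m)%N.
  apply/eqP; rewrite -(eqr_nat R) natrM !natrX -ss.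
  by rewrite !natr_absz !intr_norm !real_normK ?realz// zq; apply/eqP; ring.
move=> zqm; have : (`|q| ^ 2 %| `|z| ^ 2)%N by rewrite zqm dvdn_mulr.
rewrite dvdn_pexp2r// => /dvdnP[r zr]; exists r.
move/eqP: zqm; rewrite zr expnMn mulnC eqn_pmul2l ?expn_gt0 ?absz_gt0 ?q0//.
by move/eqP.
Qed.

Lemma sum_alternating (R : pzRingType) u :
  \sum_(a < u.*2) bsign R (odd a) = 0.
Proof.
elim: u => [|u IH]; first by rewrite big_ord0.
by rewrite doubleS !big_ord_recr /= IH odd_double /bsign expr0 add0r expr1
  subrr.
Qed.

Lemma hadamard_flat (R : realType) k (H : 'M[R]_(2 * k)) :
  (0 < k)%N -> hadamard H -> H^T = H ->
  exists (I : finType) (c : R) (S : I -> I -> R),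
    [/\ flat_kernel c S, 0 < c & #|I|%:R = c * Num.sqrt (2 * k)%:R].
Proof.
move=> k0 hadH symH.
case: (hadamard_trace0_or_square k0 hadH symH) => [tH|[r kr]].
  have k2 : 0 < (2 * k)%:R :> R by rewrite ltr0n muln_gt0.
  do 3 eexists; split; first exact: (hadamard_flat_kernel hadH symH tH).
    by rewrite mulr_gt0 ?sqrtr_gt0.
  rewrite -mulrA -expr2 sqr_sqrtr ?ltW// card_prod card_ord card_bool.
  by rewrite -natrM mulnC.
(* r^2 = 2k is even, hence so is r, and alternating block signs balance. *)
have r_even : r = r./2.*2.
  apply/esym/even_halfK; have := congr1 odd kr.
  by rewrite oddX oddM /= => <-.
have d0 : \sum_(a < r) bsign R (odd a) = 0 by rewrite r_even sum_alternating.
do 3 eexists; split; first exact: (@walsh_flat_kernel _ _ (fun a => odd a) d0).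
  by rewrite exprn_gt0.
rewrite kr natrX sqrtr_sqr ger0_norm// card_prod card_ord card_ffun card_bool
  card_ord.
by rewrite natrM natrX mulrC.
Qed.

(** * The limit *)

Definition beta_seq (R : realType) k (n : nat) : R :=
  n%:R^-1 * min_graph (fun G : sgraph n =>
    lambda R (n - k + 1)%N G + lambda R (n - k + 1)%N (compl G)).

Lemma beta_seq_ge (R : realType) k n : (0 < k <= n)%N ->
  - (1 / Num.sqrt (2 * k)%:R) - n%:R^-1 <= beta_seq R k n.
Proof.
move=> kn; have /andP[k0 kn'] := kn.
have n0 : 0 < n%:R :> R by rewrite ltr0n (leq_trans k0).
have ge (G : sgraph n) : - (n%:R / Num.sqrt (2 * k)%:R) - 1 <=
    lambda R (n - k + 1)%N G + lambda R (n - k + 1)%N (compl G).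
  exact: lambda_sum_ge.
rewrite /beta_seq [leRHS]mulrC ler_pdivlMr//.
have -> : (- (1 / Num.sqrt (2 * k)%:R) - n%:R^-1) * n%:R =
    - (n%:R / Num.sqrt (2 * k)%:R) - 1 :> R.
  by rewrite mulrBl mulVf ?gt_eqF// mulNr div1r mulrC.
by apply: le_bigmin => [|G _]; exact: ge.
Qed.

Lemma beta_seq_le (R : realType) k n (G : sgraph n) (x : R) :
  lambda R (n - k + 1) G + lambda R (n - k + 1) (compl G) <= x ->
  beta_seq R k n <= n%:R^-1 * x.
Proof.
move=> Gx; rewrite /beta_seq ler_wpM2l ?invr_ge0//.
by apply: le_trans Gx; exact: bigmin_le.
Qed.

Lemma cvg_affine_inv (R : realType) (a C : R) :
  (fun n : nat => a + C * n%:R^-1) @ \oo --> a.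
Proof.
rewrite -[X in _ --> X]addr0 -[X in _ --> _ + X](mulr0 C).
apply: cvgD; first exact: cvg_cst.
apply: cvgMr; rewrite -cvg_shiftS; exact: cvg_harmonic.
Qed.

Lemma abs_lim_beta_seq_le (R : realType) k : (0 < k)%N ->
  `|limn (beta_seq R k)| <= 1 / Num.sqrt (2 * k)%:R.
Proof.
(* The limit of a divergent sequence is the junk value 0. *)
move=> k0; have [cb|/dvgP ->] := pselect (cvgn (beta_seq R k)); last first.
  by rewrite normr0 divr_ge0.
rewrite ler_norml; apply/andP; split.
  rewrite -[X in X <= _](cvg_lim (@Rhausdorff R) (@cvg_affine_inv R _ (-1))).
  apply: ler_lim => //; first by apply/cvg_ex; eexists; exact: cvg_affine_inv.
  by near=> n; rewrite mulN1r beta_seq_ge// k0; near: n; exact: nbhs_infty_ge.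
(* For the upper half it suffices that the limit is nonpositive, which the empty graph shows. *)
apply: le_trans (_ : 0 <= _); last by rewrite divr_ge0.
apply: limr_le => //; near=> n.
have kn : (0 < k < n)%N by rewrite k0; near: n; exact: nbhs_infty_gt.
have [le1 le2] := lambda_empty_le0 R kn.
by have := beta_seq_le (lerD le1 le2); rewrite addr0 mulr0.
Unshelve. all: by end_near. Qed.

(** Both bounds differ from the limit by a multiple of 1/n: -1/n from below, and from above #|I| /
    (n sqrt(2k)), the rounding loss of the blow-up. *)
Lemma lim_beta_seq_flat (R : realType) (I : finType) (c : R) (S : I -> I -> R)
    k :
  flat_kernel c S -> 0 < c -> (0 < k)%N ->
  #|I|%:R = c * Num.sqrt (2 * k)%:R ->
  limn (beta_seq R k) = - (1 / Num.sqrt (2 * k)%:R).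
Proof.
move=> flatS c0 k0 Ic; apply: cvg_lim; first exact: Rhausdorff.
apply: (squeeze_cvgr _ (@cvg_affine_inv R _ (-1))
  (@cvg_affine_inv R _ (#|I|%:R / Num.sqrt (2 * k)%:R))).
near=> n; apply/andP; split.
  by rewrite mulN1r beta_seq_ge// k0; near: n; exact: nbhs_infty_ge.
have In : (#|I| <= n)%N by near: n; exact: nbhs_infty_ge.
have n0 : n%:R != 0 :> R.
  by rewrite pnatr_eq0 -lt0n; near: n; exact: nbhs_infty_gt.
have [G /beta_seq_le] := flat_lambda_sum_le flatS c0 k0 Ic In.
move/le_trans; apply; rewrite le_eqVlt; apply/orP; left; apply/eqP; field.
by rewrite n0 /= sqrtr_eq0 -ltNge ltr0n muln_gt0.
Unshelve. all: by end_near. Qed.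

Theorem corollary6 (R : realType) (k : nat) (hk : (1 <= k)%N) :
  `|beta R k k| <= 1 / Num.sqrt (2 * k)%:R /\
  ((exists H : 'M[R]_(2 * k), hadamard H /\ H^T = H) ->
   beta R k k = - (1 / Num.sqrt (2 * k)%:R)).
Proof.
split; first exact: abs_lim_beta_seq_le.
move=> [H [hadH symH]];
  have [I [c [S [flatS c0 Ic]]]] := hadamard_flat hk hadH symH.
exact: lim_beta_seq_flat flatS c0 hk Ic.
Qed.
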